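(* Let $X$ be a complex Banach space and let $T \in L(X)$. Then the following properties are equivalent: (1) $T$ is a pseudo B-Fredholm operator. (2) $T$ is both a left pseudo semi-B-Fredholm operator and a right pseudo semi-B-Fredholm operator.
   Context: $L(X)$ is the Banach algebra of bounded linear operators on $X$, $K(X)$ is the closed ideal of compact operators, $\mathcal{C}(X) = L(X)/K(X)$ is the Calkin algebra, and $\Pi : L(X) \to \mathcal{C}(X)$ is the natural projection. Let $A$ be a ring with unit and $p \in A$ an idempotent; put $C_p = \{x \in A : xp = px\}$. An element $a \in A$ is left (respectively right) $p$-invertible if $ap = pa$ and $a + p$ is left (respectively right) invertible in $C_p$ (i.e. the one-sided inverse can be chosen in $C_p$); it is $p$-invertible if $ap = pa$ and $a+p$ is invertible. An element $a$ of a unital Banach algebra $A$ is left generalized Drazin invertible (respectively right generalized Drazin invertible, generalized Drazin invertible) if there exists an idempotent $p \in A$ such that $a$ is left $p$-invertible (respectively right $p$-invertible, $p$-invertible) in $A$ and $ap$ is quasinilpotent. $T \in L(X)$ is a left pseudo semi-B-Fredholm operator (respectively right pseudo semi-B-Fredholm operator, pseudo B-Fredholm operator) if $\Pi(T)$ is left generalized Drazin invertible (respectively right generalized Drazin invertible, generalized Drazin invertible) in $\mathcal{C}(X)$. In the left and right definitions the idempotents are not required to coincide. *)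

(* Defs.v *)
From HB Require Import structures.
From mathcomp Require Import all_boot all_order all_algebra.
From mathcomp Require Import all_classical all_reals all_analysis.
From mathcomp Require Import complex ring lra.

Set Implicit Arguments.
Unset Strict Implicit.
Unset Printing Implicit Defensive.

Import Order.TTheory GRing.Theory Num.Theory.
Import numFieldNormedType.Exports.

Local Open Scope classical_set_scope.
Local Open Scope ring_scope.
Local Open Scope complex_scope.
Local Open Scope quotient_scope.

(* Hierarchy Builder rejects a join of Num.NormedZmodule with GRing.PzRing
   (Num.NumDomain already inherits from both), hence a separate norm. The zero
   ring is allowed: L(X) / K(X) is zero when X is finite-dimensional. *)
HB.mixin Record isNormedRing (R : realType) A of GRing.PzRing A := {
  rgnorm : A -> R;
  rgnormD : forall x y, rgnorm (x + y) <= rgnorm x + rgnorm y;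
  rgnormN : forall x, rgnorm (- x) = rgnorm x;
  rgnorm_eq0 : forall x, rgnorm x = 0 -> x = 0;
  rgnormM : forall x y, rgnorm (x * y) <= rgnorm x * rgnorm y
}.

#[short(type="normedRingType")]
HB.structure Definition NormedRing (R : realType) :=
  {A of isNormedRing R A & GRing.PzRing A}.

Section BoundedOperators.
Variables (R : realType) (X : completeNormedModType R[i]).

(* The norm of X takes its values in R[i]; this is its real counterpart. *)
Definition rnorm (x : X) : R := complex.Re `|x|.

Lemma rnormE x : `|x| = (rnorm x)%:C.
Proof. by rewrite /rnorm RRe_real // normr_real. Qed.

Lemma rnorm_ge0 x : 0 <= rnorm x.
Proof. by rewrite -lecR -rnormE normr_ge0. Qed.

Lemma rnorm_eq0 x : rnorm x = 0 -> x = 0.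
Proof. by move=> x0; apply/normr0_eq0; rewrite rnormE x0. Qed.

Lemma rnorm0 : rnorm 0 = 0.
Proof. by rewrite /rnorm normr0. Qed.

Lemma rnormD x y : rnorm (x + y) <= rnorm x + rnorm y.
Proof. by rewrite -lecR rmorphD /= -!rnormE ler_normD. Qed.

Lemma rnormN x : rnorm (- x) = rnorm x.
Proof. by rewrite /rnorm normrN. Qed.

Lemma rnormB x y : rnorm (x - y) = rnorm (y - x).
Proof. by rewrite -rnormN opprB. Qed.

Lemma rnormZ (a : R) x : 0 <= a -> rnorm (a%:C *: x) = a * rnorm x.
Proof.
move=> a0; apply: complexI; rewrite rmorphM /= -!rnormE normrZ.
by rewrite (@ger0_norm _ a%:C) // lecR.
Qed.

Definition op_bound (f : X -> X) (M : R) :=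
  0 <= M /\ forall x, rnorm (f x) <= M * rnorm x.

Definition bounded_linear (f : X -> X) := linear f /\ exists M, op_bound f M.

Definition bounded_linear_pred : {pred X -> X} := fun f => `[< bounded_linear f >].

Record boundedOp := BoundedOp {
  bop_fun :> X -> X;
  bop_funP : bop_fun \in bounded_linear_pred }.

HB.instance Definition _ := [isSub for bop_fun].
HB.instance Definition _ := [Choice of boundedOp by <:].

Lemma bounded_linear_submod : submod_closed bounded_linear_pred.
Proof.
split=> [|a f g /asboolP[lf [M [M0 fM]]] /asboolP[lg [N [N0 gN]]]]; apply/asboolP.
  split=> [b x y|]; first by rewrite /= scaler0 addr0.
  by exists 0; split=> // x; rewrite mul0r rnorm0.
split=> [b x y|].
  change (a *: f (b *: x + y) + g (b *: x + y) =
    b *: (a *: f x + g x) + (a *: f y + g y)).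
  by rewrite lf lg !scalerDr !scalerA mulrC addrACA.
exists (complex.Re `|a| * M + N); have a0 : 0 <= complex.Re `|a|.
  by rewrite -lecR RRe_real ?normr_real // normr_ge0.
split=> [|x]; first by rewrite addr_ge0 // mulr_ge0.
rewrite mulrDl; apply: le_trans (rnormD _ _) _; rewrite lerD //.
rewrite -mulrA; apply: le_trans (_ : complex.Re `|a| * rnorm (f x) <= _).
  by rewrite -lecR rmorphM /= RRe_real ?normr_real // -!rnormE normrZ.
by rewrite ler_wpM2l.
Qed.

HB.instance Definition _ :=
  GRing.isSubmodClosed.Build R[i] (X -> X) bounded_linear_pred
    bounded_linear_submod.
HB.instance Definition _ := [SubChoice_isSubLmodule of boundedOp by <:].

Implicit Types f g h : boundedOp.

Lemma bopP f g : (forall x, f x = g x) -> f = g.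
Proof. by move=> fg; apply/val_inj/funext. Qed.

Lemma bop_linear f : linear f.
Proof. by case: f => f /= /asboolP[]. Qed.

Lemma bop_bounded f : exists M, op_bound f M.
Proof. by case: f => f /= /asboolP[]. Qed.

HB.instance Definition _ f := GRing.isLinear.Build R[i] X X _ f (bop_linear f).

Lemma bopD f g x : (f + g) x = f x + g x. Proof. by []. Qed.
Lemma bopN f x : (- f) x = - f x. Proof. by []. Qed.
Lemma bopB f g x : (f - g) x = f x - g x. Proof. by []. Qed.
Lemma op_boundM (f g : X -> X) M N :
  op_bound f M -> op_bound g N -> op_bound (f \o g) (M * N).
Proof.
move=> [M0 fM] [N0 gN]; split=> [|x /=]; first exact: mulr_ge0.
by apply: le_trans (fM _) _; rewrite -mulrA ler_wpM2l.
Qed.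

Lemma bop1_subproof : id \in bounded_linear_pred.
Proof.
by apply/asboolP; split=> [//|]; exists 1; split=> // x; rewrite mul1r.
Qed.

Lemma bopM_subproof f g : f \o g \in bounded_linear_pred.
Proof.
apply/asboolP; split=> [a x y /=|]; first by rewrite !bop_linear.
have [M fM] := bop_bounded f; have [N gN] := bop_bounded g.
by exists (M * N); exact: op_boundM.
Qed.

Definition bop_one := BoundedOp bop1_subproof.
Definition bop_mul f g := BoundedOp (bopM_subproof f g).

Lemma bop_mulA : associative bop_mul.
Proof. by move=> f g h; exact: bopP. Qed.
Lemma bop_mul1 : left_id bop_one bop_mul.
Proof. by move=> f; exact: bopP. Qed.
Lemma bop_mulr1 : right_id bop_one bop_mul.
Proof. by move=> f; exact: bopP. Qed.
Lemma bop_mulDl : left_distributive bop_mul +%R.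
Proof. by move=> f g h; exact: bopP. Qed.
Lemma bop_mulDr : right_distributive bop_mul +%R.
Proof. by move=> f g h; apply: bopP => x; exact: raddfD. Qed.

HB.instance Definition _ := GRing.Zmodule_isPzRing.Build boundedOp
  bop_mulA bop_mul1 bop_mulr1 bop_mulDl bop_mulDr.

Lemma bopM f g x : (f * g) x = f (g x). Proof. by []. Qed.

Definition opnorm f : R := inf [set M | op_bound f M].

Lemma opnorm_has_inf f : has_inf [set M | op_bound f M].
Proof. by split; [exact: bop_bounded|exists 0 => M []]. Qed.

Lemma opnorm_bound f : op_bound f (opnorm f).
Proof.
split=> [|x]; first by apply: lb_le_inf; [exact: bop_bounded|move=> M []].
have [/eqP x0|x0] := boolP (rnorm x == 0).
  by have [M [_ /(_ x)]] := bop_bounded f; rewrite x0 !mulr0.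
have xgt0 : 0 < rnorm x by rewrite lt_def x0 rnorm_ge0.
rewrite -ler_pdivrMr //; apply: lb_le_inf; first exact: bop_bounded.
by move=> M [_ fM]; rewrite ler_pdivrMr.
Qed.

Lemma opnorm_le f M : op_bound f M -> opnorm f <= M.
Proof. by move=> fM; apply: ge_inf fM; exists 0 => N []. Qed.

Lemma ler_opnorm f x : rnorm (f x) <= opnorm f * rnorm x.
Proof. by have [_] := opnorm_bound f. Qed.

Lemma opnorm_ge0 f : 0 <= opnorm f.
Proof. by have [] := opnorm_bound f. Qed.

Lemma opnormD f g : opnorm (f + g) <= opnorm f + opnorm g.
Proof.
apply: opnorm_le; split=> [|x]; first by rewrite addr_ge0 ?opnorm_ge0.
by rewrite mulrDl bopD (le_trans (rnormD _ _)) // lerD // ler_opnorm.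
Qed.

Lemma opnorm_eq0 f : opnorm f = 0 -> f = 0.
Proof.
move=> f0; apply: bopP => x; apply: rnorm_eq0; apply/eqP.
by rewrite eq_le rnorm_ge0 andbT (le_trans (ler_opnorm f x)) // f0 mul0r.
Qed.

Lemma opnormN f : opnorm (- f) = opnorm f.
Proof.
by congr inf; apply/seteqP; split=> M [M0 fM]; split=> // x;
  move: (fM x); rewrite bopN rnormN.
Qed.

Lemma opnormM f g : opnorm (f * g) <= opnorm f * opnorm g.
Proof. by apply: opnorm_le; apply: op_boundM; exact: opnorm_bound. Qed.

HB.instance Definition _ := isNormedRing.Build R boundedOp
  opnormD opnormN opnorm_eq0 opnormM.

Definition unit_ball : set X := [set x | `|x| <= 1].

Definition compact_operator f := precompact (f @` unit_ball).

Definition compact_operator_pred : {pred boundedOp} :=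
  fun f => `[< compact_operator f >].

Lemma unit_ballP x : unit_ball x <-> rnorm x <= 1.
Proof. by rewrite /unit_ball /= rnormE -lecR. Qed.

Lemma bop_continuous f : continuous f.
Proof.
apply: bounded_linear_continuous; apply/bounded_funP => r.
have [M [M0 fM]] := bop_bounded f.
exists (M%:C * r) => x xr; rewrite rnormE.
apply: le_trans (_ : M%:C * `|x| <= _); last by rewrite ler_wpM2l // lecR.
by rewrite rnormE -rmorphM /= lecR.
Qed.

Lemma precompact_image (g : X -> X) (A : set X) :
  continuous g -> precompact A -> precompact (g @` A).
Proof.
move=> gc [K AK [Kc _]].
apply: precompact_subset (compact_precompact (@norm_hausdorff _ _)
  (continuous_compact (continuous_subspaceT gc) Kc)).
exact: image_subset.
Qed.

Lemma compact_operator0 : compact_operator 0.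
Proof.
apply: precompact_subset
  (compact_precompact (@norm_hausdorff _ _) (@compact_set1 X 0)).
by move=> _ [x _ <-].
Qed.

Lemma compact_operatorB f g :
  compact_operator f -> compact_operator g -> compact_operator (f - g).
Proof.
move=> [K fK [Kc _]] [L gL [Lc _]].
apply: precompact_subset (compact_precompact (@norm_hausdorff _ _)
  (continuous_compact (continuous_subspaceT (@sub_continuous X))
     (compact_setX Kc Lc))).
move=> _ [x x1 <-]; exists (f x, g x) => //; split => /=.
  by apply: fK; exists x.
by apply: gL; exists x.
Qed.

Lemma compact_operatorMl f g : compact_operator g -> compact_operator (f * g).
Proof.
move=> gc; rewrite /compact_operator.
rewrite (_ : _ @` _ = f @` (g @` unit_ball)); last by rewrite image_comp.
by apply: precompact_image gc; exact: bop_continuous.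
Qed.

Lemma compact_operatorMr f g : compact_operator g -> compact_operator (g * f).
Proof.
move=> gc; pose M := opnorm f + 1.
have M0 : 0 < M by rewrite ltr_wpDl ?opnorm_ge0.
apply: precompact_subset
  (precompact_image (g := fun x => M%:C *: x) _ gc); last first.
  by move=> x; exact: scaler_continuous.
move=> _ [x x1 <-].
exists (g ((M^-1)%:C *: f x)).
  exists ((M^-1)%:C *: f x) => //; apply/unit_ballP.
  rewrite rnormZ ?invr_ge0 ?(ltW M0) // ler_pdivrMl // mulr1.
  apply: le_trans (ler_opnorm _ _) _.
  apply: le_trans (_ : opnorm f * 1 <= _).
    by rewrite ler_wpM2l ?opnorm_ge0 //; exact/unit_ballP.
  by rewrite mulr1 lerDl.
rewrite linearZ scalerA -rmorphM /= mulfV ?gt_eqF // rmorph1 scale1r.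
by [].
Qed.

Lemma compact_operator_closed f :
  (forall e : R, 0 < e -> exists2 g, compact_operator g & opnorm (f - g) < e) ->
  compact_operator f.
Proof.
move=> fa; rewrite /compact_operator precompactE compact_ultra => F FU Fcl.
suff /cauchy_cvg Fcvg : cauchy F.
  exists (lim F); split=> //.
  apply: (@closed_cvg _ _ F _ id (closure (f @` unit_ball))) => //.
  exact: closed_closure.
apply: cauchy_exP => e e0.
pose d := complex.Re e / 3.
have eE : (complex.Re e)%:C = e by rewrite RRe_real // gtr0_real.
have d0 : 0 < d by rewrite divr_gt0 // -ltcR eE.
have dC0 : 0 < d%:C by rewrite ltcR.
have [g [K gK [Kc _]] fgd] := fa d d0.
pose thick (P : set X) : set X :=
  K `&` [set k | exists2 p, P p & rnorm (p - k) <= d + d].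
pose G : set_system X := [set A | exists2 P, F P & thick P `<=` A].
have ballP x y (r : R) : ball x r%:C y <-> rnorm (x - y) < r.
  by rewrite -ball_normE /ball_ /= rnormE ltcR.
have thickP P : F P -> exists k, thick P k.
  move=> FP; have [y [Py ycl]] := filter_ex (filterI FP Fcl).
  have [z [[x x1 <-] /ballP yx]] := ycl _ (nbhsx_ballx y (d%:C) dC0).
  exists (g x); split; first by apply: gK; exists x.
  exists y => //; rewrite -(subrKA (f x)); apply: le_trans (rnormD _ _) _.
  rewrite lerD ?ltW // -bopB; apply: le_lt_trans fgd.
  apply: le_trans (ler_opnorm _ _) _.
  by rewrite ler_piMr ?opnorm_ge0 //; exact/unit_ballP.
have GF : ProperFilter G.
  split; first by move=> [P /thickP[k Pk] /(_ _ Pk)].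
  split.
  - by exists setT => //; exact: filterT.
  - move=> A B [P FP PA] [Q FQ QB]; exists (P `&` Q); first exact: filterI.
    by move=> k [Kk [p [Pp Qp] pk]]; split; [apply: PA|apply: QB];
      split=> //; exists p.
  - by move=> A B AB [P FP PA]; exists P => // k /PA/AB.
have [|k [Kk kG]] := Kc G GF; first by exists setT; [exact: filterT|move=> k []].
exists k; have [//|FC] := in_ultra_setVsetC (ball k e) FU.
have GC : G (thick (~` ball k e)) by exists (~` ball k e).
have [j [[_ [p pe pj]] /ballP kj]] := kG _ _ GC (nbhsx_ballx k (d%:C) dC0).
exfalso; apply: pe; rewrite -eE; apply/ballP.
rewrite -(subrKA j); apply: le_lt_trans (rnormD _ _) _.
rewrite (_ : complex.Re e = d + (d + d)); last by rewrite /d; field.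
by rewrite ltr_leD // rnormB.
Qed.

Lemma compact_operator_zmod : zmod_closed compact_operator_pred.
Proof.
split; first by apply/asboolP; exact: compact_operator0.
by move=> f g /asboolP fc /asboolP gc; apply/asboolP; exact: compact_operatorB.
Qed.

HB.instance Definition _ :=
  GRing.isZmodClosed.Build boundedOp compact_operator_pred compact_operator_zmod.

Definition calkin := Quotient.quot compact_operator_pred.

HB.instance Definition _ := Choice.on calkin.
HB.instance Definition _ := GRing.Zmodule.on calkin.
HB.instance Definition _ := ZmodQuotient.on calkin.

Definition calkin_proj f : calkin := \pi_calkin f.

Implicit Types a b c : calkin.

Lemma calkin_projP a : exists f, calkin_proj f = a.
Proof. by exists (repr a); rewrite /calkin_proj reprK. Qed.

Lemma calkin_proj_eq f g :
  calkin_proj f = calkin_proj g <-> compact_operator (f - g).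
Proof.
rewrite /calkin_proj; split=> [/eqP|fg].
  by rewrite -Quotient.idealrBE => /asboolP.
by apply/eqP; rewrite -Quotient.idealrBE; apply/asboolP.
Qed.

Lemma calkin_projB : {morph calkin_proj : f g / f - g}.
Proof. by move=> f g; rewrite /calkin_proj !piE. Qed.

Lemma calkin_projD : {morph calkin_proj : f g / f + g}.
Proof. by move=> f g; rewrite /calkin_proj !piE. Qed.

Definition calkin_one : calkin := calkin_proj 1.
(* independent of the representatives, see calkin_projM *)
Definition calkin_mul a b : calkin := calkin_proj (repr a * repr b).

Lemma calkin_projM f g :
  calkin_proj (f * g) = calkin_mul (calkin_proj f) (calkin_proj g).
Proof.
set f' := repr (calkin_proj f); set g' := repr (calkin_proj g).
have ff' : compact_operator (f - f').
  by apply/calkin_proj_eq; rewrite /calkin_proj reprK.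
have gg' : compact_operator (g - g').
  by apply/calkin_proj_eq; rewrite /calkin_proj reprK.
apply/calkin_proj_eq; rewrite -/f' -/g'.
rewrite (_ : _ - _ = f * (g - g') - (f' - f) * g'); last first.
  by rewrite mulrBr mulrBl opprB addrA subrK.
apply: compact_operatorB; first exact: compact_operatorMl.
apply: compact_operatorMr; rewrite -opprB -[- _]add0r.
exact: compact_operatorB compact_operator0 ff'.
Qed.

Lemma calkin_mulA : associative calkin_mul.
Proof.
move=> a b c; have [f <-] := calkin_projP a; have [g <-] := calkin_projP b.
by have [h <-] := calkin_projP c; rewrite -!calkin_projM mulrA.
Qed.

Lemma calkin_mul1 : left_id calkin_one calkin_mul.
Proof.
by move=> a; have [f <-] := calkin_projP a; rewrite -calkin_projM mul1r.
Qed.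

Lemma calkin_mulr1 : right_id calkin_one calkin_mul.
Proof.
by move=> a; have [f <-] := calkin_projP a; rewrite -calkin_projM mulr1.
Qed.

Lemma calkin_mulDl : left_distributive calkin_mul +%R.
Proof.
move=> a b c; have [f <-] := calkin_projP a; have [g <-] := calkin_projP b.
have [h <-] := calkin_projP c.
by rewrite -calkin_projD -!calkin_projM -calkin_projD mulrDl.
Qed.

Lemma calkin_mulDr : right_distributive calkin_mul +%R.
Proof.
move=> a b c; have [f <-] := calkin_projP a; have [g <-] := calkin_projP b.
have [h <-] := calkin_projP c.
by rewrite -calkin_projD -!calkin_projM -calkin_projD mulrDr.
Qed.

HB.instance Definition _ := GRing.Zmodule_isPzRing.Build calkin
  calkin_mulA calkin_mul1 calkin_mulr1 calkin_mulDl calkin_mulDr.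

HB.instance Definition _ :=
  GRing.isZmodMorphism.Build boundedOp calkin calkin_proj calkin_projB.
HB.instance Definition _ := GRing.isMonoidMorphism.Build boundedOp calkin
  calkin_proj (erefl _, calkin_projM).

(* the quotient norm, i.e. the distance from f to K(X) when a = calkin_proj f *)
Definition calkin_norm a : R :=
  inf [set opnorm f | f in [set f | calkin_proj f = a]].

Lemma calkin_norm_le f : calkin_norm (calkin_proj f) <= opnorm f.
Proof.
apply: ge_inf; last by exists f.
by exists 0 => _ [g _ <-]; exact: opnorm_ge0.
Qed.

Lemma calkin_norm_ge0 a : 0 <= calkin_norm a.
Proof.
apply: lb_le_inf; last by move=> _ [g _ <-]; exact: opnorm_ge0.
by have [f fa] := calkin_projP a; exists (opnorm f), f.
Qed.

Lemma calkin_norm_lt a (e : R) : 0 < e ->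
  exists2 f, calkin_proj f = a & opnorm f < calkin_norm a + e.
Proof.
move=> e0; have [|_ [f fa <-] fe] := @inf_adherent R
    [set opnorm f | f in [set f | calkin_proj f = a]] e e0.
  split; last by exists 0 => _ [g _ <-]; exact: opnorm_ge0.
  by have [f fa] := calkin_projP a; exists (opnorm f), f.
by exists f.
Qed.

Lemma calkin_normD a b : calkin_norm (a + b) <= calkin_norm a + calkin_norm b.
Proof.
apply/ler_addgt0Pr => e e0; have e2 : 0 < e / 2 by rewrite divr_gt0.
have [f <- fe] := calkin_norm_lt a e2; have [g <- ge] := calkin_norm_lt b e2.
rewrite -calkin_projD (le_trans (calkin_norm_le _)) //.
rewrite (le_trans (opnormD _ _)) // [e in leRHS]splitr addrACA.
by rewrite lerD // ltW.
Qed.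

Lemma calkin_normN a : calkin_norm (- a) = calkin_norm a.
Proof.
suff le b : calkin_norm (- b) <= calkin_norm b.
  by apply/eqP; rewrite eq_le le -{1}(opprK a) le.
apply/ler_addgt0Pr => e e0; have [f <- fe] := calkin_norm_lt b e0.
rewrite -raddfN; apply: le_trans (calkin_norm_le _) _.
by rewrite opnormN ltW.
Qed.

Lemma calkin_norm_eq0 a : calkin_norm a = 0 -> a = 0.
Proof.
have [f <-] := calkin_projP a => f0.
rewrite -(raddf0 calkin_proj); apply/calkin_proj_eq; rewrite subr0.
apply: compact_operator_closed => e e0.
have [g /calkin_proj_eq gf ge] := calkin_norm_lt (calkin_proj f) e0.
exists (f - g); last by rewrite subKr; move: ge; rewrite f0 add0r.
by rewrite -opprB -[- _]add0r; exact: compact_operatorB compact_operator0 gf.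
Qed.

Lemma calkin_normM a b : calkin_norm (a * b) <= calkin_norm a * calkin_norm b.
Proof.
apply/ler_addgt0Pr => e e0.
pose s := calkin_norm a + calkin_norm b + 1.
have s0 : 0 < s by rewrite ltr_wpDl // addr_ge0 ?calkin_norm_ge0.
pose d := Num.min 1 (e / s).
have d0 : 0 < d by rewrite lt_min ltr01 divr_gt0.
have [f fa fd] := calkin_norm_lt a d0; have [g gb gd] := calkin_norm_lt b d0.
rewrite -{1}fa -{1}gb -(rmorphM calkin_proj).
apply: le_trans (calkin_norm_le _) _; apply: le_trans (opnormM _ _) _.
apply: le_trans (_ : (calkin_norm a + d) * (calkin_norm b + d) <= _).
  by apply: ler_pM (opnorm_ge0 _) (opnorm_ge0 _) (ltW fd) (ltW gd).
rewrite mulrDr !mulrDl -!addrA lerD2l addrA.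
have ds : d * s <= e by rewrite -ler_pdivlMr // ge_min lexx orbT.
apply: le_trans ds; rewrite /s !mulrDr mulr1 -!addrA addrCA (mulrC d (_ b)).
have d1 : d <= 1 by rewrite ge_min lexx.
rewrite [leRHS]addrCA (mulrC d (calkin_norm a)).
have dd : d * d <= d by rewrite -[leRHS]mulr1 ler_wpM2l // ltW.
lra.
Qed.

HB.instance Definition _ := isNormedRing.Build R calkin
  calkin_normD calkin_normN calkin_norm_eq0 calkin_normM.

End BoundedOperators.

Section PInvertible.
Variable A : pzRingType.
Implicit Types p a : A.

Definition commutant p : set A := [set x | x * p = p * x].

Definition left_p_invertible p a :=
  a * p = p * a /\ exists2 b, commutant p b & b * (a + p) = 1.

Definition right_p_invertible p a :=
  a * p = p * a /\ exists2 b, commutant p b & (a + p) * b = 1.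

Definition p_invertible p a :=
  a * p = p * a /\ exists b, b * (a + p) = 1 /\ (a + p) * b = 1.

End PInvertible.

Section GeneralizedDrazin.
Variables (R : realType) (A : normedRingType R).
Implicit Types p a : A.

(* the spectral radius lim_n |a ^ n| ^ (1 / n) is zero; n = 0 is irrelevant *)
Definition quasinilpotent a :=
  (fun n => rgnorm (a ^+ n) `^ n%:R^-1) @ \oo --> (0 : R).

Definition left_generalized_Drazin_invertible a :=
  exists p, [/\ p * p = p, left_p_invertible p a & quasinilpotent (a * p)].

Definition right_generalized_Drazin_invertible a :=
  exists p, [/\ p * p = p, right_p_invertible p a & quasinilpotent (a * p)].

Definition generalized_Drazin_invertible a :=
  exists p, [/\ p * p = p, p_invertible p a & quasinilpotent (a * p)].

End GeneralizedDrazin.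

Section PseudoBFredholm.
Variables (R : realType) (X : completeNormedModType R[i]).
Implicit Types T : boundedOp X.

Definition left_pseudo_semi_B_Fredholm T :=
  left_generalized_Drazin_invertible (calkin_proj T).

Definition right_pseudo_semi_B_Fredholm T :=
  right_generalized_Drazin_invertible (calkin_proj T).

Definition pseudo_B_Fredholm T :=
  generalized_Drazin_invertible (calkin_proj T).

End PseudoBFredholm.

(* Main.v *)
Require Import Defs.
From mathcomp Require Import all_boot all_order all_algebra.
From mathcomp Require Import all_classical all_reals all_analysis.
From mathcomp Require Import complex.
From mathcomp Require Import lra.

(** The equivalence holds in every normed ring, because the idempotent of a
    left generalized Drazin inverse and that of a right one coincide as soon as
    both exist.  Let [p] and [q] be these idempotents for [a].  Cutting the
    one-sided inverses of [a + p] and [a + q] down to the complementary corners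
    gives [b] and [c] with [b * a = 1 - p] and [a * c = 1 - q], where [b]
    commutes with [p] and [c] with [q].  Hence [b ^+ n * a ^+ n = 1 - p] for
    every [n > 0], so that [(1 - p) * q = b ^+ n * (a * q) ^+ n].  The norm of
    the right-hand side is at most [|b| ^+ n * |(a * q) ^+ n|], which tends to
    zero because [a * q] is quasinilpotent: the powers of a quasinilpotent
    element decay faster than any geometric sequence grows.  Therefore
    [(1 - p) * q = 0], and the mirror argument gives [p * (1 - q) = 0], so
    [p = p * q = q].  The element [a + p] now has a left and a right inverse,
    hence is invertible. *)

Set Implicit Arguments.
Unset Strict Implicit.
Unset Printing Implicit Defensive.

Import Order.TTheory GRing.Theory Num.Theory.
Import numFieldNormedType.Exports.

Local Open Scope classical_set_scope.
Local Open Scope ring_scope.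

Section Corners.
Variable A : pzRingType.
Implicit Types a b p x : A.

Lemma commutant_compl p x : commutant p x -> commutant (1 - p) x.
Proof. by rewrite /commutant /= => xp; rewrite mulrBr mulrBl mulr1 mul1r xp. Qed.

Lemma mul_idempotent_compl p : p * p = p -> p * (1 - p) = 0.
Proof. by move=> pp; rewrite mulrBr mulr1 pp subrr. Qed.

Lemma mul_compl_idempotent p : p * p = p -> (1 - p) * p = 0.
Proof. by move=> pp; rewrite mulrBl mul1r pp subrr. Qed.

Lemma idempotent_compl p : p * p = p -> (1 - p) * (1 - p) = 1 - p.
Proof. by move=> pp; rewrite mulrBr mulr1 mul_compl_idempotent // subr0. Qed.

(** The summand [p] of [a + p] is killed by [1 - p], so the left inverse of
    [a + p] restricts to a left inverse of [a] in the corner of [1 - p]. *)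
Lemma left_p_invertible_corner p a : p * p = p -> left_p_invertible p a ->
  exists2 b, commutant (1 - p) b & b * a = 1 - p.
Proof.
move=> pp [ap [b bp bap]]; have be := commutant_compl bp.
have ae : commutant (1 - p) a by exact: commutant_compl.
exists (b * (1 - p)).
  by rewrite /commutant /= mulrA -be -mulrA.
rewrite -mulrA -ae -[RHS]mul1r -[X in _ = X * _]bap -[RHS]mulrA.
by rewrite mulrDl (mul_idempotent_compl pp) addr0.
Qed.

Lemma right_p_invertible_corner p a : p * p = p -> right_p_invertible p a ->
  exists2 c, commutant (1 - p) c & a * c = 1 - p.
Proof.
move=> pp [ap [c cp acp]]; have ce := commutant_compl cp.
have ae : commutant (1 - p) a by exact: commutant_compl.
exists ((1 - p) * c).
  by rewrite /commutant /= -mulrA ce.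
rewrite mulrA ae -[RHS]mulr1 -[X in _ = _ * X]acp [RHS]mulrA.
by rewrite mulrDr (mul_compl_idempotent pp) addr0.
Qed.

Lemma expr_left_inverse_corner e a b n : e * e = e -> commutant e b ->
  b * a = e -> b ^+ n.+1 * a ^+ n.+1 = e.
Proof.
move=> ee be ba; elim: n => [|n IHn]; first by rewrite !expr1.
by rewrite (exprS b) (exprSr a) -mulrA (mulrA (b ^+ _)) IHn mulrA be -mulrA ba.
Qed.

Lemma expr_right_inverse_corner e a c n : e * e = e -> commutant e c ->
  a * c = e -> a ^+ n.+1 * c ^+ n.+1 = e.
Proof.
move=> ee ce ac; elim: n => [|n IHn]; first by rewrite !expr1.
by rewrite (exprS a) (exprSr c) -mulrA (mulrA (a ^+ _)) IHn -ce mulrA ac.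
Qed.

Lemma exprM_idempotent p a n : p * p = p -> a * p = p * a ->
  (a * p) ^+ n.+1 = a ^+ n.+1 * p.
Proof.
move=> pp ap; elim: n => [|n IHn]; first by rewrite !expr1.
by rewrite exprSr IHn -mulrA (mulrA p) -ap -mulrA pp mulrA -exprSr.
Qed.

End Corners.

Section NormedRingTheory.
Variables (R : realType) (A : normedRingType R).
Implicit Types a b c p q x z : A.

Lemma rgnorm_ge0 x : 0 <= rgnorm x :> R.
Proof.
have n0 : 0 <= rgnorm (0 : A) :> R.
  by have := rgnormD (0 : A) 0; rewrite addr0; lra.
by have := rgnormD x (- x); rewrite rgnormN subrr; lra.
Qed.

(** At exponent zero the bound would read [rgnorm 1 <= 1], which can fail. *)
Lemma rgnormX x n : rgnorm (x ^+ n.+1) <= rgnorm x ^+ n.+1 :> R.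
Proof.
elim: n => [|n IHn]; first by rewrite !expr1.
rewrite exprS [leRHS]exprS; apply: le_trans (rgnormM _ _) _.
by rewrite ler_wpM2l ?rgnorm_ge0.
Qed.

(** Unfolds the spectral radius: the [n]-th root of the norm of [x ^+ n] is
    eventually below any [e > 0]. *)
Lemma quasinilpotent_near x (e : R) : quasinilpotent x -> 0 < e ->
  \forall n \near \oo, rgnorm (x ^+ n.+1) <= e ^+ n.+1.
Proof.
move=> xq e0.
have [N _ xN] : \forall n \near \oo, rgnorm (x ^+ n) `^ n%:R^-1 < e.
  exact: (cvgr_lt _ xq).
exists N => // n /= Nn.
have /ltW ne : rgnorm (x ^+ n.+1) `^ n.+1%:R^-1 < e.
  by apply: xN; exact: leqW.
have nK : n.+1%:R^-1 * n.+1%:R = 1 :> R by rewrite mulVf ?pnatr_eq0.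
rewrite -[leLHS](powRr1 (rgnorm_ge0 _)) -nK powRrM powR_mulrn ?powR_ge0 //.
by rewrite lerXn2r ?nnegrE ?powR_ge0 // ltW.
Qed.

(** The norms of the powers of [x] decay faster than any geometric sequence, so
    no growth of [M ^+ n] can compensate them. *)
Lemma eq0_quasinilpotent x z (M : R) : quasinilpotent x -> 0 <= M ->
  (forall n, rgnorm z <= M ^+ n.+1 * rgnorm (x ^+ n.+1)) -> z = 0.
Proof.
move=> xq M0 zM; apply: (@rgnorm_eq0 R); apply/eqP; rewrite eq_le rgnorm_ge0 andbT.
apply/negPn/negP; rewrite -ltNge => z0.
(* This [e] makes the bounds on [z] eventually smaller than (1 / 2) ^ n. *)
pose e : R := (2 * (M + 1))^-1.
have e0 : 0 < e by rewrite invr_gt0; lra.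
have Me : M * e <= 2^-1.
  by rewrite /e ler_pdivrMr; lra.
have half : \forall n \near \oo, (2^-1 : R) ^+ n < rgnorm z.
  by apply: (cvgr_lt (0 : R)) => //; apply: cvg_expr; rewrite ger0_norm; lra.
have [n [xn zn]] := filter_ex (filterI (quasinilpotent_near xq e0) half).
have : rgnorm z <= (2^-1 : R) ^+ n.
  apply: le_trans (zM n) _.
  apply: le_trans (_ : (M * e) ^+ n.+1 <= _).
    by rewrite exprMn ler_wpM2l ?exprn_ge0.
  apply: le_trans (_ : (2^-1 : R) ^+ n.+1 <= _).
    by rewrite lerXn2r ?nnegrE // mulr_ge0 // ltW.
  by rewrite exprS ler_piMl ?exprn_ge0; lra.
by rewrite leNgt zn.
Qed.

(** For [n > 0], [e * q = b ^+ n * a ^+ n * q = b ^+ n * (a * q) ^+ n]. *)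
Lemma left_corner_quasinilpotent e a b q :
  e * e = e -> commutant e b -> b * a = e ->
  q * q = q -> a * q = q * a -> quasinilpotent (a * q) -> e * q = 0.
Proof.
move=> ee be ba qq aq aqn.
apply: (eq0_quasinilpotent aqn (rgnorm_ge0 b)) => n.
rewrite -{1}(expr_left_inverse_corner n ee be ba) -mulrA.
rewrite -(exprM_idempotent n qq aq).
by apply: le_trans (rgnormM _ _) _; rewrite ler_wpM2r ?rgnorm_ge0 ?rgnormX.
Qed.

Lemma right_corner_quasinilpotent e a c p :
  e * e = e -> commutant e c -> a * c = e ->
  p * p = p -> a * p = p * a -> quasinilpotent (a * p) -> p * e = 0.
Proof.
move=> ee ce ac pp ap apn.
apply: (eq0_quasinilpotent apn (rgnorm_ge0 c)) => n.
have pa : p * a ^+ n.+1 = a ^+ n.+1 * p by apply: commrX; rewrite /GRing.comm.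
rewrite -{1}(expr_right_inverse_corner n ee ce ac) mulrA pa.
rewrite -(exprM_idempotent n pp ap).
apply: le_trans (rgnormM _ _) _; rewrite mulrC.
by rewrite ler_wpM2r ?rgnorm_ge0 ?rgnormX.
Qed.

(** Uniqueness of the idempotent: [q] is killed by [1 - p] on the left and [p]
    by [1 - q] on the right, so both are equal to [p * q]. *)
Lemma left_right_p_invertible_eq p q a : p * p = p -> q * q = q ->
  left_p_invertible p a -> quasinilpotent (a * p) ->
  right_p_invertible q a -> quasinilpotent (a * q) -> p = q.
Proof.
move=> pp qq pa apn qa aqn.
have [b be ba] := left_p_invertible_corner pp pa.
have [c ce ac] := right_p_invertible_corner qq qa.
have := left_corner_quasinilpotent (idempotent_compl pp) be ba qq qa.1 aqn.
have := right_corner_quasinilpotent (idempotent_compl qq) ce ac pp pa.1 apn.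
by rewrite mulrBr mulr1 mulrBl mul1r => /subr0_eq p_pq /subr0_eq q_pq;
  rewrite p_pq -q_pq.
Qed.

End NormedRingTheory.

(** A two-sided inverse of [a + p] automatically commutes with [p], since
    [a + p] does. *)
Lemma p_invertibleP (A : pzRingType) (p a : A) :
  p_invertible p a <-> left_p_invertible p a /\ right_p_invertible p a.
Proof.
split=> [[ap [b [ba ab]]]|[[ap [b _ ba]] [_ [c _ ac]]]].
  have bp : commutant p b.
    have app : (a + p) * p = p * (a + p) by rewrite mulrDl mulrDr ap.
    by rewrite /commutant /= -[LHS]mulr1 -ab mulrA -(mulrA b) -app mulrA ba mul1r.
  by split; split=> //; exists b.
split=> //; exists b; split=> //.
by rewrite (_ : b = c) // -[b]mulr1 -ac mulrA ba mul1r.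
Qed.

Lemma generalized_Drazin_invertibleP (R : realType) (A : normedRingType R)
    (a : A) :
  generalized_Drazin_invertible a <->
  left_generalized_Drazin_invertible a /\ right_generalized_Drazin_invertible a.
Proof.
split=> [[p [pp /p_invertibleP[pl pr] apn]]|].
  by split; exists p.
move=> [[p [pp pa apn]] [q [qq qa aqn]]]; exists p; split=> //.
apply/p_invertibleP; split=> //.
by rewrite (left_right_p_invertible_eq pp qq pa apn qa aqn).
Qed.

Theorem theorem3p7 (R : realType) (X : completeNormedModType R[i])
    (T : boundedOp X) :
  pseudo_B_Fredholm T <->
  left_pseudo_semi_B_Fredholm T /\ right_pseudo_semi_B_Fredholm T.
Proof. exact: generalized_Drazin_invertibleP. Qed.
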